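(* Let $A,B\in \mathbb{C}^{n\times n}$ be group matrices such that $A^{\mathrm{core}}B + A^{\mathrm{core}}A=0$ and $BA^{\mathrm{core}}+AA^{\mathrm{core}}=0$. Then the following conditions are equivalent: (i) $AB=BA$; (ii) $A^2=-AB$; (iii) $A^2\le_{c} B^2$; (iv) $A+B\le_{c} B$; (v) $(A+B)^{\mathrm{core}}= A^{\mathrm{core}}+B^{\mathrm{core}}$.
   Context: A square matrix $M$ is a group matrix if it has index at most $1$, i.e. $\operatorname{rank}(M)=\operatorname{rank}(M^2)$. The core inverse $M^{\mathrm{core}}$ of a square matrix $M$ is the unique matrix $X$ (when it exists) with $MX=MM^\dagger$ and $\mathcal{R}(X)\subseteq\mathcal{R}(M)$, where $M^\dagger$ is the Moore-Penrose inverse and $\mathcal{R}$ denotes column space; it exists if and only if $M$ is a group matrix. The core partial order $\le_c$ is defined, for group matrices $M,N\in\mathbb{C}^{n\times n}$, by: $M\le_c N$ if and only if $M^{\mathrm{core}}M=M^{\mathrm{core}}N$ and $MM^{\mathrm{core}}=NM^{\mathrm{core}}$. Statements (iv) and (v) are understood to include that $A+B$ is a group matrix. *)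

(* Defs.v *)
From HB Require Import structures.
From mathcomp Require Import all_boot all_order all_algebra.
From mathcomp Require Import sesquilinear spectral.
From mathcomp Require Import complex.
From mathcomp Require Import boolp classical_sets reals.

Set Implicit Arguments.
Unset Strict Implicit.
Unset Printing Implicit Defensive.

Import Order.TTheory GRing.Theory Num.Theory.
Local Open Scope ring_scope.
Local Open Scope sesquilinear_scope.

Definition group_mx {C : fieldType} {n} (M : 'M[C]_n) : Prop :=
  \rank M = \rank (M *m M).

Definition is_mpinv {C : numClosedFieldType} {n} (M X : 'M[C]_n) : Prop :=
  [/\ M *m X *m M = M,
      X *m M *m X = X,
      (M *m X)^t* = M *m X &
      (X *m M)^t* = X *m M].

Definition mpinv {C : numClosedFieldType} {n} (M : 'M[C]_n) : 'M[C]_n :=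
  xget 0 [set X | is_mpinv M X]%classic.

(* [%MS] compares row spaces, hence the transposes for column spaces. *)
Definition colspace_sub {C : fieldType} {m n p}
    (X : 'M[C]_(m, n)) (M : 'M[C]_(m, p)) : Prop :=
  (X^T <= M^T)%MS.

Definition is_core_inv {C : numClosedFieldType} {n} (M X : 'M[C]_n) : Prop :=
  M *m X = M *m mpinv M /\ colspace_sub X M.

(* Equal to [0] when [M] has no core inverse, that is, by [core_inv_existsP]
   below, when [M] is not a group matrix. *)
Definition core_inv {C : numClosedFieldType} {n} (M : 'M[C]_n) : 'M[C]_n :=
  xget 0 [set X | is_core_inv M X]%classic.

Definition core_le {C : numClosedFieldType} {n} (M N : 'M[C]_n) : Prop :=
  [/\ group_mx M, group_mx N,
      core_inv M *m M = core_inv M *m N &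
      M *m core_inv M = N *m core_inv M].

Lemma trmxC_mul {C : numClosedFieldType} {m n p}
    (A : 'M[C]_(m, n)) (B : 'M[C]_(n, p)) : (A *m B)^t* = B^t* *m A^t*.
Proof. by rewrite trmx_mul map_mxM. Qed.

Lemma mulmx_trmxC_eq0 {C : numClosedFieldType} {m n} (A : 'M[C]_(m, n)) :
  A *m A^t* = 0 -> A = 0.
Proof.
move=> A0; apply/matrixP=> i j; rewrite mxE.
have /eqP := congr1 (fun M : 'M_m => M i i) A0.
rewrite !mxE psumr_eq0 => [|k _]; last by rewrite !mxE mul_conjC_ge0.
by move=> /allP /(_ j (mem_index_enum _)); rewrite !mxE mul_conjC_eq0 => /eqP.
Qed.

Lemma gram_unit {C : numClosedFieldType} {m n} (A : 'M[C]_(m, n)) :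
  row_free A -> A *m A^t* \in unitmx.
Proof.
move=> fA; rewrite -row_free_unit -kermx_eq0; apply/eqP.
have K0 := mulmx_ker (A *m A^t*).
apply: (row_free_inj fA); rewrite mul0mx; apply: mulmx_trmxC_eq0.
by rewrite trmxC_mul mulmxA -(mulmxA (kermx _)) K0 mul0mx.
Qed.

Lemma is_mpinv_mpinv {C : numClosedFieldType} {n} (M : 'M[C]_n) :
  is_mpinv M (mpinv M).
Proof.
suff eX : exists X, is_mpinv M X by apply: (xgetPex 0 eX).
set F := col_base M; set G := row_base M.
have MFG : M = F *m G by rewrite mulmx_base.
have uG : G *m G^t* \in unitmx by apply: gram_unit; rewrite row_base_free.
have uF : F^t* *m F \in unitmx.
  rewrite -{2}[F]trmxCK; apply: gram_unit.
  by rewrite /row_free mxrank_map mxrank_tr; exact: (col_base_full M).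
move: F G MFG uG uF; move: (\rank M) => r F G MFG uG uF.
exists (G^t* *m invmx (G *m G^t*) *m (invmx (F^t* *m F) *m F^t*)).
set P := invmx (G *m _); set Q := invmx (_ *m F).
have GP : G *m G^t* *m P = 1%:M by rewrite mulmxV.
have QF : Q *m (F^t* *m F) = 1%:M by rewrite mulVmx.
have PG : P *m (G *m G^t*) = 1%:M by rewrite mulVmx.
have FQ : F^t* *m F *m Q = 1%:M by rewrite mulmxV.
have Ph : P^t* = P.
  have : (G *m G^t*) *m P^t* = 1%:M.
    have := congr1 (fun Z : 'M_ _ => Z^t*) PG.
    by rewrite !trmxC_mul trmxCK trmx1 map_mx1.
  by move/(congr1 (mulmx P)); rewrite mulmxA PG mul1mx mulmx1.
have Qh : Q^t* = Q.
  have : Q^t* *m (F^t* *m F) = 1%:M.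
    have := congr1 (fun Z : 'M_ _ => Z^t*) FQ.
    by rewrite !trmxC_mul trmxCK trmx1 map_mx1.
  by move/(congr1 (mulmx^~ Q)); rewrite -mulmxA FQ mul1mx mulmx1.
have MX : M *m (G^t* *m P *m (Q *m F^t*)) = F *m Q *m F^t*.
  by rewrite MFG -!mulmxA (mulmxA G) (mulmxA (G *m _)) GP mul1mx.
have XM : G^t* *m P *m (Q *m F^t*) *m M = G^t* *m P *m G.
  by rewrite MFG -!mulmxA (mulmxA _ F G) (mulmxA Q) QF mul1mx.
split.
- by rewrite MX {1}MFG -!mulmxA (mulmxA _ F G) (mulmxA Q) QF mul1mx.
- by rewrite XM -!mulmxA (mulmxA G) (mulmxA (G *m _)) GP mul1mx.
- by rewrite MX !trmxC_mul Qh trmxCK mulmxA.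
- by rewrite XM !trmxC_mul Ph trmxCK mulmxA.
Qed.

Lemma is_mpinv_unique {C : numClosedFieldType} {n} (M X : 'M[C]_n) :
  is_mpinv M X -> X = mpinv M.
Proof.
move: (is_mpinv_mpinv M); move: (mpinv M) => Y [y1 y2 y3 y4] [x1 x2 x3 x4].
have e1 : M *m X = M *m Y.
  by rewrite -x3 -{1}y1 -mulmxA trmxC_mul x3 y3 !mulmxA x1.
have e2 : X *m M = Y *m M.
  by rewrite -x4 -{1}y1 !mulmxA -[X *m M *m Y *m M]mulmxA trmxC_mul x4 y4
    -mulmxA [M *m _]mulmxA x1.
by rewrite -x2 -mulmxA e1 mulmxA e2.
Qed.

Lemma core_inv_existsP {C : numClosedFieldType} {n} (M : 'M[C]_n) :
  (exists X, is_core_inv M X) <-> group_mx M.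
Proof.
have [m1 _ _ _] := is_mpinv_mpinv M; split.
  move=> [X [MX /submxP [Y /(congr1 trmx)]]].
  rewrite trmx_mul !trmxK => XY; apply/eqP.
  rewrite /group_mx eqn_leq mxrankM_maxl andbT -{1}m1 -MX XY.
  by rewrite !mulmxA -mulmxA mxrankM_maxl.
move=> gM.
have /submxP [Y /(congr1 trmx)] : (M^T <= (M *m M)^T)%MS.
  have : ((M *m M)^T == M^T)%MS.
    by rewrite -(geq_leqif (mxrank_leqif_eq _)) ?mxrank_tr ?gM //
      trmx_mul submxMl.
  by case/andP.
rewrite trmx_mul !trmxK => MY.
exists (M *m (Y^T *m mpinv M)); split; first by rewrite !mulmxA -MY.
by rewrite /colspace_sub trmx_mul submxMl.
Qed.

Lemma is_core_inv_unique {C : numClosedFieldType} {n} (M X : 'M[C]_n) :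
  is_core_inv M X -> X = core_inv M.
Proof.
move=> cX.
have gM : group_mx M by apply/core_inv_existsP; exists X.
have := xgetI 0 cX : is_core_inv M (core_inv M).
rewrite -/(core_inv M) => -[e2 s2]; case: cX => e1 s1.
have : ((X - core_inv M)^T <= M^T :&: kermx M^T)%MS.
  rewrite sub_capmx linearB /= addmx_sub ?eqmx_opp //=; apply/sub_kermxP.
  by rewrite -linearB -trmx_mul mulmxBr e1 e2 subrr trmx0.
have /eqP -> : (M^T :&: kermx M^T)%MS == 0.
  rewrite -mxrank_eq0 -(eqn_add2l (\rank (M^T *m M^T))) mxrank_mul_ker addn0.
  by rewrite -trmx_mul !mxrank_tr; apply/eqP.
by rewrite submx0 -[0]trmx0 (inj_eq trmx_inj) subr_eq0 => /eqP.
Qed.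

(* Main.v *)
(* Put E = A + B and x = core(A); the hypotheses say exactly x E = 0 = E x,
   hence E A = 0 and (A x) E = 0.  Relative to the range of A and its orthogonal
   complement, A = [T S; 0 0] with T invertible, E = [0 0; 0 D] and
   B = [-T -S; 0 D], so E is a group matrix along with B, and
   core(E) = (1 - A x) core(B).  Each of the five conditions
   amounts to S D = 0, that is, to A E = 0. *)
Require Import Defs.
From mathcomp Require Import all_boot all_order all_algebra.
From mathcomp Require Import sesquilinear spectral.
From mathcomp Require Import complex reals.
Import GRing.Theory.
Local Open Scope ring_scope.
Local Open Scope complex_scope.
Local Open Scope sesquilinear_scope.

Lemma trmxCD {K : numClosedFieldType} {m n} (M N : 'M[K]_(m, n)) :
  (M + N)^t* = M^t* + N^t*.
Proof. by rewrite linearD map_mxD. Qed.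

Lemma trmxCN {K : numClosedFieldType} {m n} (M : 'M[K]_(m, n)) :
  (- M)^t* = - M^t*.
Proof. by rewrite linearN map_mxN. Qed.

(** Purely algebraic form of the core inverse. If [M *m X] is Hermitian and fixes [M], it is the
    orthogonal projector onto the range of [M], which is also what [M *m mpinv M] is;
    [M *m X *m X = X] encodes the range inclusion. *)
Lemma is_core_invP {K : numClosedFieldType} {n} (M X : 'M[K]_n) :
  is_core_inv M X <->
  [/\ M *m X *m M = M, (M *m X)^t* = M *m X & M *m X *m X = X].
Proof.
have [m1 m2 m3 _] := is_mpinv_mpinv M; split=> [[MX]|[MXM MXh MXX]].
  move=> /submxP [Y /(congr1 trmx)]; rewrite trmx_mul !trmxK => XY.
  by rewrite MX; split=> //; rewrite XY mulmxA m1.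
split; last by rewrite /colspace_sub -MXX -mulmxA trmx_mul submxMl.
by rewrite -MXh -{1}m1 -mulmxA trmxC_mul MXh m3 mulmxA MXM.
Qed.

Lemma core_invE {K : numClosedFieldType} {n} (M X : 'M[K]_n) :
    [/\ M *m X *m M = M, (M *m X)^t* = M *m X & M *m X *m X = X] ->
  group_mx M /\ core_inv M = X.
Proof.
move/is_core_invP=> cX; split; last by rewrite -(is_core_inv_unique cX).
by apply/core_inv_existsP; exists X.
Qed.

Lemma group_core_inv {K : numClosedFieldType} {n} {M : 'M[K]_n} :
    group_mx M ->
  [/\ M *m core_inv M *m M = M,
      (M *m core_inv M)^t* = M *m core_inv M,
      M *m core_inv M *m core_inv M = core_inv M,
      core_inv M *m M *m M = M &
      core_inv M *m M *m core_inv M = core_inv M].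
Proof.
move=> gM; have [X cX] := (core_inv_existsP M).2 gM.
rewrite -(is_core_inv_unique cX); case/is_core_invP: cX => e1 e2 e3.
(* Equal ranks make the row spaces of [M] and its square coincide, so M = V M M. Then X = M X X = V
   M M X X = V M X, which yields X M M = V M M = M. *)
have /submxP [V MV] : (M <= M *m M)%MS.
  have : (M *m M == M)%MS.
    by rewrite -(geq_leqif (mxrank_leqif_eq _)) ?gM // submxMl.
  by case/andP.
have XMM : X *m M *m M = M.
  have -> : X = V *m M *m X.
    by rewrite -{1}e3 {1}MV -!mulmxA (mulmxA M X X) e3.
  by rewrite -!mulmxA (mulmxA X) (mulmxA M) (mulmxA M X) e1 -MV.
split=> //.
by rewrite -{2}e3 !mulmxA XMM e3.
Qed.

Lemma core_inv_sqr {K : numClosedFieldType} {n} {M : 'M[K]_n} :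
    group_mx M ->
  group_mx (M *m M) /\ core_inv (M *m M) = core_inv M *m core_inv M.
Proof.
move=> /group_core_inv [e1 e2 e3 e4 e5]; apply: core_invE.
by rewrite !mulmxA -(mulmxA M M) -(mulmxA M) e3 e1 e2 e3.
Qed.

Section CoreSum.
Variables (K : numClosedFieldType) (n : nat) (A B : 'M[K]_n).
Hypotheses (gA : group_mx A) (gB : group_mx B).
Hypotheses (hl : core_inv A *m B + core_inv A *m A = 0)
           (hr : B *m core_inv A + A *m core_inv A = 0).

Let x := core_inv A.
Let y := core_inv B.
Let P := A *m x.
Let E := A + B.

Let xE : x *m E = 0. Proof. by rewrite mulmxDr addrC. Qed.
Let Ex : E *m x = 0. Proof. by rewrite mulmxDl addrC. Qed.

Let PE : P *m E = 0. Proof. by rewrite -mulmxA xE mulmx0. Qed.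
Let EP : E *m P = 0.
Proof.
have [_ _ _ e4 _] := group_core_inv gA.
(* Since A = x A A, the range of [A] lies in that of [x], which [E] kills. *)
by rewrite /P -{1}e4 !mulmxA Ex !mul0mx.
Qed.
Let EA : E *m A = 0.
Proof. by have [e1 _ _ _ _] := group_core_inv gA; rewrite -e1 mulmxA EP mul0mx. Qed.

Let BE : B = E - A. Proof. by rewrite /E addrC addKr. Qed.
Let BA : B *m A = - (A *m A). Proof. by rewrite BE mulmxBl EA sub0r. Qed.

(* From A = A (A x x) A and B A = - A A: the range of A lies in that of B. *)
Let A_rangeB : A = B *m (- (A *m x *m x *m A)).
Proof.
have [e1 _ e3 _ _] := group_core_inv gA.
by rewrite mulmxN !mulmxA BA !mulNmx opprK -(mulmxA A) -(mulmxA A) e3 e1.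
Qed.

(** [B *m y] is the orthogonal projector onto the range of [B], hence fixes [P]; take adjoints. *)
Let P_By : P *m (B *m y) = P.
Proof.
have [f1 f2 _ _ _] := group_core_inv gB; have [_ e2 _ _ _] := group_core_inv gA.
have ByP : B *m y *m P = P by rewrite /P A_rangeB !mulmxA f1.
by move/(congr1 (fun Z : 'M_n => Z^t*)): ByP; rewrite trmxC_mul e2 f2.
Qed.

Let Ay : A *m y = - P.
Proof.
have [e1 _ _ _ _] := group_core_inv gA.
have PB : P *m B = - A by rewrite BE mulmxBr PE sub0r e1.
by rewrite -P_By mulmxA PB mulNmx opprK.
Qed.

Let Ey : E *m y = B *m y - P.
Proof. by rewrite mulmxDl Ay addrC. Qed.

(** [y] cancels one factor in [B *m B], so [A] is factored through the square of [B] by using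
    [A_rangeB] twice. *)
Let yA : y *m A = - (x *m A).
Proof.
have [_ _ _ f4 _] := group_core_inv gB; have [e1 _ e3 _ _] := group_core_inv gA.
have ABB : A = B *m B *m (A *m x *m x *m A *m x *m x *m A).
  by rewrite {1}A_rangeB {1}A_rangeB !(mulmxN, mulNmx) opprK !mulmxA.
have -> : y *m A = B *m (A *m x *m x *m A *m x *m x *m A).
  by rewrite {1}ABB !mulmxA f4.
by rewrite !mulmxA BA !mulNmx -(mulmxA A A) -(mulmxA A) e3 e1 e3.
Qed.

Let F := y - P *m y.

(** [E *m F] is [B *m y - P], a difference of nested orthogonal projectors, hence Hermitian. It
    fixes [E] because [B *m y] fixes both [A] and [B] while P E = 0. *)
Lemma core_inv_add : group_mx E /\ core_inv E = F.
Proof.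
have [f1 f2 f3 _ _] := group_core_inv gB; have [e1 e2 _ _ _] := group_core_inv gA.
have EF : E *m F = B *m y - P by rewrite mulmxBr mulmxA EP mul0mx subr0 Ey.
apply: core_invE; rewrite EF; split.
- have ByA : B *m y *m A = A by rewrite {1}A_rangeB mulmxA f1 -A_rangeB.
  by rewrite mulmxBl PE subr0 mulmxDr f1 ByA.
- by rewrite trmxCD trmxCN f2 e2.
- have PP : P *m P = P by rewrite /P mulmxA e1.
  have ByP : B *m y *m P = P by rewrite /P A_rangeB !mulmxA f1.
  rewrite mulmxBr !mulmxBl (mulmxA (B *m y)) (mulmxA P P) f3 ByP PP.
  by rewrite subrr subr0.
Qed.

(** [E] and its core inverse [F] have the same range: F = E F F and E = F E E. *)
Let AE0_AF0 : A *m E = 0 <-> A *m F = 0.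
Proof.
have [gE <-] := core_inv_add; have [_ _ g3 g4 _] := group_core_inv gE.
split=> h; first by rewrite -g3 !mulmxA h !mul0mx.
by rewrite -g4 !mulmxA h !mul0mx.
Qed.

Lemma comm_add_AE0 : A *m B = B *m A <-> A *m E = 0.
Proof.
rewrite BA /E mulmxDr; split=> [->|/eqP]; first by rewrite subrr.
by rewrite addrC addr_eq0 => /eqP.
Qed.

Lemma sqr_oppM_AE0 : A *m A = - (A *m B) <-> A *m E = 0.
Proof.
rewrite /E mulmxDr; split=> [->|/eqP]; first by rewrite addNr.
by rewrite addr_eq0 => /eqP.
Qed.

(** The right-hand equation of the order always holds because E x = 0. The left-hand one says x x A
    E = 0, and multiplying by [A *m A] recovers A E. *)
Lemma core_le_sqr_AE0 : core_le (A *m A) (B *m B) <-> A *m E = 0.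
Proof.
have [gA2 A2] := core_inv_sqr gA; have [gB2 _] := core_inv_sqr gB.
have [e1 _ e3 _ _] := group_core_inv gA.
have B2 : B *m B = A *m A + E *m E - A *m E.
  by rewrite BE mulmxBl !mulmxBr EA subr0 opprB addrCA addrA.
have l : x *m x *m (B *m B) = x *m x *m (A *m A) - x *m x *m A *m E.
  rewrite B2 mulmxBr mulmxDr -(mulmxA x x (E *m E)) (mulmxA x E E) xE.
  by rewrite mul0mx mulmx0 addr0 -(mulmxA _ A E).
have r : B *m B *m (x *m x) = A *m A *m (x *m x).
  rewrite B2 mulmxBl mulmxDl -!(mulmxA _ E) (mulmxA E x) Ex.
  by rewrite !(mul0mx, mulmx0) addr0 subr0.
split=> [[_ _ + _]|AE0].
  rewrite A2 l => /esym /eqP; rewrite subr_eq -subr_eq0 opprD addNKr oppr_eq0 => /eqP h.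
  have -> : A *m E = A *m A *m (x *m x *m A *m E).
    by rewrite !mulmxA -(mulmxA A A) -(mulmxA A) e3 e1.
  by rewrite h mulmx0.
split=> //; rewrite A2 //.
by rewrite l -(mulmxA _ A E) AE0 mulmx0 subr0.
Qed.

(** Here the left-hand equation is automatic, since F A = 0; the right-hand one, E F = B F, says A F
    = 0. *)
Lemma core_le_add_AE0 : core_le E B <-> A *m E = 0.
Proof.
have [gE cE] := core_inv_add; have [_ _ e3 _ _] := group_core_inv gA.
have FA : F *m A = 0.
  by rewrite mulmxBl -mulmxA yA mulmxN opprK !mulmxA e3 addNr.
have FB : F *m B = F *m E by rewrite BE mulmxBr FA subr0.
split=> [[_ _ _]|/AE0_AF0 AF].
  rewrite cE BE mulmxBl => /eqP.
  rewrite eq_sym -subr_eq0 addrAC subrr sub0r oppr_eq0.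
  by move/eqP/AE0_AF0.
by split=> //; rewrite cE ?FB // BE mulmxBl AF subr0.
Qed.

Lemma core_inv_add_AE0 :
  group_mx E /\ core_inv E = x + y <-> A *m E = 0.
Proof.
have [gE cE] := core_inv_add.
have [_ _ _ e4 e5] := group_core_inv gA.
(* The claimed formula for [core_inv E] amounts to x = - P y. Multiplying by [A] on the left turns
   this into A F = 0; multiplying by [x] goes back, as x P = x and x A P = P. *)
have AF : A *m F = - (P + A *m P *m y) by rewrite mulmxBr Ay opprD mulmxA.
rewrite AE0_AF0 cE AF; split=> [[_]|].
  rewrite /F addrC => /addIr /(congr1 (mulmx A)).
  by rewrite mulmxN mulmxA -/P => h; rewrite -{1}h addNr oppr0.
move=> /(congr1 (mulmx x)); rewrite mulmx0 mulmxN => /eqP.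
rewrite oppr_eq0 mulmxDr => /eqP; rewrite /P !mulmxA e5 e4 -/P => h.
split=> //; rewrite /F addrC; congr (_ + _).
by apply/esym/eqP; rewrite -addr_eq0 h.
Qed.

End CoreSum.

Theorem theorem3p12 (R : realType) (n : nat) (A B : 'M[R[i]]_n)
    (hA : group_mx A) (hB : group_mx B)
    (hl : core_inv A *m B + core_inv A *m A = 0)
    (hr : B *m core_inv A + A *m core_inv A = 0) :
  [<-> A *m B = B *m A;
       A *m A = - (A *m B);
       core_le (A *m A) (B *m B);
       core_le (A + B) B;
       group_mx (A + B) /\ core_inv (A + B) = core_inv A + core_inv B].
Proof.
have i1 := comm_add_AE0 _ _ _ _ hA hr.
have i2 := sqr_oppM_AE0 _ _ A B.
have i3 := core_le_sqr_AE0 _ _ _ _ hA hB hl hr.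
have i4 := core_le_add_AE0 _ _ _ _ hA hB hl hr.
have i5 := core_inv_add_AE0 _ _ _ _ hA hB hl hr.
by tfae; tauto.
Qed.
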